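(* Let $R$ be a commutative Noetherian local ring with maximal ideal $\mathfrak m$, and let $x,y$ be part of a minimal system of generators of $\mathfrak m$ with $xy=0$. Then the residue field $R/\mathfrak m$ does not belong to the smallest extension-closed subcategory of $\operatorname{mod} R$ containing $R/(x)$, and hence this smallest extension-closed subcategory is a nontrivial extension-closed subcategory of $\operatorname{mod} R$.
   Context: $\operatorname{mod} R$ is the category of finitely generated $R$-modules. A subcategory of $\operatorname{mod} R$ always means a nonempty full subcategory closed under isomorphism. A subcategory is extension-closed if it is closed under direct summands and closed under extensions (for every exact sequence $0\to L\to M\to N\to 0$ in $\operatorname{mod} R$ with $L,N$ in the subcategory, $M$ is also in it). The trivial extension-closed subcategories are: the one consisting of zero modules, the one consisting of all finitely generated free $R$-modules, and $\operatorname{mod} R$ itself; any other extension-closed subcategory is called nontrivial. ''$x,y$ are part of a minimal system of generators of $\mathfrak m$'' means that the images of $x,y$ in $\mathfrak m/\mathfrak m^2$ are linearly independent over $R/\mathfrak m$. *)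

(* Defs.v *)
From HB Require Import structures.
From mathcomp Require Import all_boot all_algebra.
From mathcomp Require Import boolp.
Set Implicit Arguments.
Unset Strict Implicit.
Unset Printing Implicit Defensive.
Import GRing.Theory.
Local Open Scope ring_scope.
Local Open Scope quotient_scope.

(* For a submodule S of V, the library's [{ideal_quot _}] is only a zmodType;
   here it becomes an R-module.  [submod_pred] carries the closure under
   opposites, which is not part of [submodClosed]. *)
Section QuotientModule.
Variables (R : comNzRingType) (V : lmodType R) (S : submodClosed V).

Definition submod_pred : {pred V} := S.

Lemma submod_pred_zmod_closed : zmod_closed submod_pred.
Proof.
split=> [|u v uS vS]; first exact: (rpred0 S).
by rewrite -scaleN1r; apply: (rpredD uS); exact: rpredZ.
Qed.

HB.instance Definition _ := GRing.isZmodClosed.Build V submod_pred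
  submod_pred_zmod_closed.

Local Notation VS := {ideal_quot submod_pred}.

Definition quot_scale (a : R) (u : VS) : VS := \pi_VS (a *: repr u).

Lemma quot_scale_pi a (v : V) :
  quot_scale a (\pi_VS v) = \pi_VS (a *: v).
Proof.
rewrite /quot_scale; apply/eqP; rewrite -Quotient.idealrBE -scalerBr.
apply: (@rpredZ _ _ S); rewrite -[_ \in _]/(_ \in submod_pred).
by rewrite Quotient.idealrBE reprK.
Qed.

Lemma quot_scalerA a b u : quot_scale a (quot_scale b u) = quot_scale (a * b) u.
Proof. by rewrite -[u]reprK (quot_scale_pi b) !quot_scale_pi scalerA. Qed.

Lemma quot_scale1r : left_id 1 quot_scale.
Proof. by move=> u; rewrite -[u]reprK quot_scale_pi scale1r. Qed.

Lemma quot_scalerDr : right_distributive quot_scale +%R.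
Proof.
move=> a u v; rewrite -[u]reprK -[v]reprK -raddfD !quot_scale_pi.
by rewrite scalerDr raddfD.
Qed.

Lemma quot_scalerDl u : {morph quot_scale^~ u : a b / a + b}.
Proof. by move=> a b; rewrite -[u]reprK !quot_scale_pi scalerDl raddfD. Qed.

HB.instance Definition _ := GRing.Zmodule_isLmodule.Build R VS
  quot_scalerA quot_scale1r quot_scalerDr quot_scalerDl.

Definition quotmod : lmodType R := VS.

End QuotientModule.

Section Ideals.
Variable R : comNzRingType.

(* Ideals of R are the submodules of the regular module [R^o]; the boolean
   membership is no restriction, as excluded middle is available. *)
Definition maximal_ideal (I : submodClosed R^o) : Prop :=
  1 \notin I /\
  forall J : submodClosed R^o, {subset I <= J} -> 1 \notin J -> J =i I.

Definition local_ring (m : submodClosed R^o) : Prop :=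
  maximal_ideal m /\ forall J : submodClosed R^o, maximal_ideal J -> J =i m.

Definition noetherian_ring : Prop :=
  forall I : submodClosed R^o, exists (n : nat) (g : 'I_n -> R),
    (forall i, g i \in I) /\
    forall a, a \in I -> exists c : 'I_n -> R, a = \sum_i c i * g i.

Definition principal (x : R) : {pred R^o} :=
  fun a => `[< exists b : R, a = b * x >].

Lemma principal_submod_closed x : submod_closed (principal x).
Proof.
split=> [|a u v /asboolP[b ->] /asboolP[c ->]]; apply/asboolP.
  by exists 0; rewrite mul0r.
by exists (a * b + c); rewrite mulrDl -mulrA.
Qed.

HB.instance Definition _ x := GRing.isSubmodClosed.Build R R^o (principal x)
  (principal_submod_closed x).

Definition in_square (m : submodClosed R^o) (z : R) : Prop :=
  exists (n : nat) (a b : 'I_n -> R),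
    (forall i, a i \in m /\ b i \in m) /\ z = \sum_i a i * b i.

(* The classes of x and y in m/m^2 are linearly independent over R/m, written
   out on representatives: the class of a is zero in R/m iff [a \in m], and
   a[x] + b[y] is zero in m/m^2 iff a x + b y lies in m^2. *)
Definition part_of_minimal_generators (m : submodClosed R^o) (x y : R) : Prop :=
  [/\ x \in m, y \in m
    & forall a b : R, in_square m (a * x + b * y) -> a \in m /\ b \in m].

End Ideals.

Section Subcategories.
Variable R : comNzRingType.
Implicit Types L M N : lmodType R.

Definition fin_gen M : Prop :=
  exists (n : nat) (g : 'I_n -> M),
    forall u : M, exists c : 'I_n -> R, u = \sum_i c i *: g i.

Definition isomorphic M N : Prop := exists f : {linear M -> N}, bijective f.

Definition short_exact L M N (f : {linear L -> M}) (g : {linear M -> N}) : Prop :=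
  [/\ injective f, forall v : N, exists u : M, g u = v
    & forall u : M, g u = 0 <-> exists v : L, f v = u].

(* A full subcategory of mod R is given by its class of objects. *)
Definition subcategory (C : lmodType R -> Prop) : Prop :=
  [/\ exists M, C M, forall M, C M -> fin_gen M
    & forall M N, isomorphic M N -> C M -> C N].

Definition extension_closed (C : lmodType R -> Prop) : Prop :=
  [/\ subcategory C,
      forall M L N, isomorphic M (L * N)%type -> C M -> C L
    & forall L M N (f : {linear L -> M}) (g : {linear M -> N}),
        fin_gen M -> short_exact f g -> C L -> C N -> C M].

Definition same_objects (C D : lmodType R -> Prop) : Prop :=
  forall M, C M <-> D M.

Definition zero_module M : Prop := forall u : M, u = 0.

Definition fin_free M : Prop := exists n : nat, isomorphic 'rV[R]_n M.

Definition nontrivial_extension_closed (C : lmodType R -> Prop) : Prop :=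
  [/\ extension_closed C, ~ same_objects C zero_module,
      ~ same_objects C fin_free & ~ same_objects C fin_gen].

Definition ext_closure X : lmodType R -> Prop :=
  fun M => forall C, extension_closed C -> C X -> C M.

End Subcategories.

(* Main.v *)
Require Import Defs.
From HB Require Import structures.
From mathcomp Require Import all_boot all_algebra.
From mathcomp Require Import boolp.
From mathcomp Require Import zify.
Set Implicit Arguments.
Unset Strict Implicit.
Unset Printing Implicit Defensive.
Import GRing.Theory.
Local Open Scope ring_scope.
Local Open Scope quotient_scope.

(** A module with a filtration whose quotients are all R/(x) is the cokernel of
    an upper triangular matrix T with x on the diagonal, and a triangular matrix
    U with y on the diagonal satisfies U T = 0.  If both have their off-diagonal
    entries in m, then U C = D T forces the entries of C and D into m, because x
    and y are independent modulo m^2.  Applied to the off-diagonal block C of an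
    extension, this shows that such modules are stable under extensions; applied
    with U the scalar y, it shows that an element u of such a module M with
    y u = 0 lies in m M.  A direct summand R/m of M would be generated by an
    element that is annihilated by y and lies outside m M. *)

(** * Quotient modules *)

Section QuotientModuleTheory.
Variables (R : comNzRingType) (V : lmodType R) (S : submodClosed V).

Definition quotmod_pi (v : V) : quotmod S :=
  \pi_{ideal_quot (submod_pred S)} v.

Lemma quotmod_pi_surj (u : quotmod S) : exists v, quotmod_pi v = u.
Proof. by exists (repr u); rewrite /quotmod_pi reprK. Qed.

Lemma quotmod_piZ a v : quotmod_pi (a *: v) = a *: quotmod_pi v.
Proof. by rewrite -[RHS]/(quot_scale _ _) quot_scale_pi. Qed.

Lemma quotmod_pi_eq0 v : quotmod_pi v = 0 <-> v \in S.
Proof.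
have -> : (v \in S) = (quotmod_pi v == 0).
  rewrite -[v in LHS]subr0 -[_ \in _]/(_ \in submod_pred S).
  by rewrite Quotient.idealrBE /quotmod_pi raddf0.
by split=> /eqP.
Qed.

End QuotientModuleTheory.

(** * The square of an ideal, and triangular matrices over it *)

Section SquareOfIdeal.
Variables (R : comNzRingType) (m : submodClosed R^o).

Lemma ideal_mull (a b : R) : b \in m -> a * b \in m.
Proof. exact: (@rpredZ _ _ m a b). Qed.

Lemma in_square0 : in_square m 0.
Proof. by exists 0%N, (fun _ => 0), (fun _ => 0); rewrite big_ord0; split=> // -[]. Qed.

Lemma in_squareM (a b : R) : a \in m -> b \in m -> in_square m (a * b).
Proof.
by move=> am bm; exists 1%N, (fun _ => a), (fun _ => b); rewrite big_ord1.
Qed.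

Lemma in_squareD (u v : R) : in_square m u -> in_square m v -> in_square m (u + v).
Proof.
move=> [p [a [b [abm ->]]]] [q [c [d [cdm ->]]]].
pose glue (s : 'I_p -> R) (t : 'I_q -> R) i :=
  match split i with inl k => s k | inr k => t k end.
exists (p + q)%N, (glue a c), (glue b d); split=> [i|].
  by rewrite /glue; case: (split i).
rewrite big_split_ord /glue; congr (_ + _); apply: eq_bigr => i _.
  by rewrite (unsplitK (inl i)).
by rewrite (unsplitK (inr i)).
Qed.

Lemma in_squareN (u : R) : in_square m u -> in_square m (- u).
Proof.
move=> [p [a [b [abm ->]]]]; exists p, (fun i => - 1 * a i), b; split=> [i|].
  by have [am bm] := abm i; split=> //; apply: ideal_mull.
by rewrite -sumrN; apply: eq_bigr => i _; rewrite mulN1r mulNr.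
Qed.

Lemma in_square_sum (I : finType) (P : pred I) (F : I -> R) :
  (forall i, P i -> in_square m (F i)) -> in_square m (\sum_(i | P i) F i).
Proof. by move=> Fm; apply: big_ind => //; [exact: in_square0|exact: in_squareD]. Qed.

Definition upper_over (x : R) n (T : 'M[R]_n) : Prop :=
  forall i j : 'I_n, [/\ (i < j)%N -> T i j \in m, (j < i)%N -> T i j = 0
    & i = j -> T i j = x].

Lemma upper_over_scalar x : upper_over x (x%:M : 'M_1).
Proof. by move=> i j; rewrite !ord1 mxE. Qed.

Lemma upper_over_block x p q (T : 'M_p) (C : 'M_(p, q)) (T' : 'M_q) :
  upper_over x T -> upper_over x T' -> (forall i j, C i j \in m) ->
  upper_over x (block_mx T C 0 T').
Proof.
move=> xT xT' mC i j; rewrite -[i]splitK -[j]splitK.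
case: (split i) => k; case: (split j) => l /=.
- by rewrite block_mxEul; case: (xT k l) => ? ? e; split=> // /lshift_inj.
- rewrite block_mxEur; split=> // [|/eqP].
    by move/ltn_trans/(_ (ltn_ord k)); rewrite ltnNge leq_addr.
  by rewrite eq_lrshift.
- rewrite block_mxEdl mxE; split=> // [_|/eqP]; first exact: (rpred0 m).
  by rewrite eq_rlshift.
rewrite block_mxEdr /= !ltn_add2l.
by case: (xT' k l) => ? ? e; split=> // /rshift_inj.
Qed.

(* Entry (i, j) of the equation reads y C_ij - x D_ij in m^2 once the entries
   of C below it and the entries of D to its left are known to lie in m. *)
Lemma upper_over_intertwine x y p q (U : 'M_p) (T : 'M_q) (C D : 'M_(p, q)) :
    part_of_minimal_generators m x y -> upper_over y U -> upper_over x T ->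
  U *m C = D *m T -> forall i j, C i j \in m /\ D i j \in m.
Proof.
move=> [_ _ indep] yU xT eqCD i j.
(* The measure drops on moving down a column of [C] or left along a row of [D]. *)
have [k] := ubnP (p - i + j); elim: k i j => // k IHk i j lt_k.
suff sq: in_square m (- D i j * x + C i j * y).
  have [DNm Cm] := indep _ _ sq; split=> //.
  by rewrite -[D i j]opprK -mulN1r; apply: ideal_mull.
have /matrixP/(_ i j) := eqCD; rewrite !mxE (bigD1 i) //= [RHS](bigD1 j) //=.
have [_ _ -> //] := yU i i; have [_ _ -> //] := xT j j.
set A := \sum_(_ | _) _; set B := \sum_(_ | _) _ => eqAB.
have -> : - D i j * x + C i j * y = B - A.
  by rewrite mulNr [C i j * y]mulrC -(addrK A (y * C i j)) eqAB -addrA addKr.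
(* By triangularity the terms of [B] vanish for [l > j] and those of [A] for [l < i]. Each other
   term multiplies an off-diagonal entry of [T] or [U] by an entry of [D] or [C] covered by
   induction. *)
apply: in_squareD; last apply: in_squareN; apply: in_square_sum => l.
  rewrite -val_eqE /= neq_ltn; have [Tm T0 _] := xT l j.
  case: ltngtP => // [lt_lj _|lt_jl _]; last by rewrite T0 // mulr0; exact: in_square0.
  apply: in_squareM (Tm lt_lj); have [|_ Dm //] := IHk i l; lia.
rewrite -val_eqE /= neq_ltn; have [Um U0 _] := yU i l.
case: ltngtP => // [lt_li _|lt_il _]; first by rewrite U0 // mul0r; exact: in_square0.
apply: in_squareM; first exact: Um.
by have [|Cm _ //] := IHk l j; have := ltn_ord l; lia.
Qed.

End SquareOfIdeal.

(** * Presentations of modules by matrices *)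

Section Combinations.
Variable R : comNzRingType.

Definition comb (M : lmodType R) n (g : 'I_n -> M) (v : 'rV[R]_n) : M :=
  \sum_i v 0 i *: g i.

(** Maps are bare functions with a proof of linearity, so that explicit maps between products can be
    used directly. *)
Lemma linear_zmod (M N : lmodType R) (f : M -> N) : linear f ->
  [/\ f 0 = 0, {morph f : u / - u} & {morph f : u v / u + v}].
Proof.
move=> lf; pose F : {linear M -> N} :=
  HB.pack f (GRing.isLinear.Build _ _ _ _ f lf).
by split; [exact: (linear0 F)|exact: (linearN F)|exact: (linearD F)].
Qed.

Lemma linear_comb (M N : lmodType R) (f : M -> N) n (g : 'I_n -> M) v :
  linear f -> f (comb g v) = comb (f \o g) v.
Proof.
move=> lf; pose F : {linear M -> N} :=
  HB.pack f (GRing.isLinear.Build _ _ _ _ f lf).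
rewrite -[f]/(F : M -> N) linear_sum; apply: eq_bigr => i _; exact: linearZ.
Qed.

Lemma comb_linear (M : lmodType R) n (g : 'I_n -> M) : linear (comb g).
Proof.
move=> a u v; rewrite scaler_sumr -big_split; apply: eq_bigr => i _ /=.
by rewrite !mxE scalerDl scalerA.
Qed.

Lemma combD (M : lmodType R) n (g : 'I_n -> M) u v :
  comb g (u + v) = comb g u + comb g v.
Proof. by rewrite -[u in LHS]scale1r comb_linear scale1r. Qed.

Lemma comb0 (M : lmodType R) n (g : 'I_n -> M) : comb g 0 = 0.
Proof. by apply: big1 => i _; rewrite mxE scale0r. Qed.

Lemma combZ (M : lmodType R) n (g : 'I_n -> M) a v :
  comb g (a *: v) = a *: comb g v.
Proof. by rewrite -[_ *: v]addr0 comb_linear comb0 addr0. Qed.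

Lemma combN (M : lmodType R) n (g : 'I_n -> M) v : comb g (- v) = - comb g v.
Proof. by rewrite -[- v]scaleN1r combZ scaleN1r. Qed.

Lemma comb_mulmx (M : lmodType R) p n (g : 'I_n -> M) (v : 'rV_p) (B : 'M_(p, n)) :
  comb g (v *m B) = comb (fun i => comb g (row i B)) v.
Proof.
rewrite /comb (eq_bigr (fun j => \sum_i (v 0 i * B i j) *: g j)) => [|j _].
  rewrite exchange_big; apply: eq_bigr => i _; rewrite scaler_sumr.
  by apply: eq_bigr => j _; rewrite mxE scalerA.
by rewrite mxE scaler_suml.
Qed.

(** Exactness of R^p -> R^n -> M -> 0, with matrices acting on row vectors from the right. *)
Definition presented_by (M : lmodType R) p n (B : 'M_(p, n)) (g : 'I_n -> M) :=
  (forall u, exists v, comb g v = u) /\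
  (forall v, comb g v = 0 <-> exists w, v = w *m B).

Lemma presented_by_iso (M N : lmodType R) (f : M -> N) p n (B : 'M_(p, n))
    (g : 'I_n -> M) :
  linear f -> bijective f -> presented_by B g -> presented_by B (f \o g).
Proof.
move=> lf [f' fK f'K] [g_surj g_ker]; split=> [u|v].
  by have [v gv] := g_surj (f' u); exists v; rewrite -linear_comb // gv f'K.
have [f0 _ _] := linear_zmod lf.
by rewrite -g_ker -linear_comb //; split=> [|-> //]; rewrite -f0 => /(can_inj fK).
Qed.

(* The horseshoe lemma for the start of a free resolution. *)
Lemma presented_by_extension (L M N : lmodType R) (f : L -> M) (g : M -> N)
    p n p' n' (B : 'M_(p, n)) (a : 'I_n -> L) (B' : 'M_(p', n')) (b : 'I_n' -> N) :
    linear f -> linear g -> injective f -> (forall v, exists u, g u = v) ->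
    (forall u, g u = 0 <-> exists v, f v = u) ->
    presented_by B a -> presented_by B' b ->
  exists (C : 'M_(p', n)) (c : 'I_(n' + n) -> M),
    presented_by (block_mx B' C 0 B) c /\
    forall v : 'rV_p', v *m B' = 0 -> exists w, v *m C = w *m B.
Proof.
move=> lf lg f_inj g_surj fg_ex [a_surj a_ker] [b_surj b_ker].
have [f0 fN fD] := linear_zmod lf; have [_ gN gD] := linear_zmod lg.
have [h gh] := choice (fun i => g_surj (b i)).
have ghv v : g (comb h v) = comb b v.
  by rewrite linear_comb //; apply: eq_bigr => i _; rewrite /= gh.
(* A relation of [N], evaluated at the lifts [h] of its generators, lands in ker g = im f. The sign
   in [C] then turns it into a relation of [M]. *)
have /choice[rel relP] i : exists w, f (comb a w) = comb h (row i B').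
  have /fg_ex[l fl] : g (comb h (row i B')) = 0.
    by rewrite ghv b_ker; exists (delta_mx 0 i); rewrite rowE.
  by have [w aw] := a_surj l; exists w; rewrite aw.
pose C := \matrix_i (- rel i).
pose c i := match split i with inl k => h k | inr k => f (a k) end.
have cE v w : comb c (row_mx v w) = comb h v + f (comb a w).
  rewrite /comb big_split_ord -/(comb a w) linear_comb //.
  congr (_ + _); apply: eq_bigr => i _; rewrite /c ?row_mxEl ?row_mxEr.
    by rewrite (unsplitK (inl i)).
  by rewrite (unsplitK (inr i)).
have hf w : comb h (w *m B') + f (comb a (w *m C)) = 0.
  rewrite !comb_mulmx linear_comb // /comb -big_split big1 // => i _ /=.
  rewrite -scalerDr -/(comb h _) -/(comb a _) -relP rowK combN fN.
  by rewrite subrr scaler0.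
have hfD v w w' : comb h v + f (comb a (w + w')) =
    comb h v + f (comb a w) + f (comb a w').
  by rewrite combD fD addrA.
exists C, c; split; [split|].
- move=> u; have [v bv] := b_surj (g u).
  have /fg_ex[l fl] : g (u - comb h v) = 0.
    by rewrite gD gN ghv bv subrr.
  have [w aw] := a_surj l; exists (row_mx v w).
  by rewrite cE aw fl addrC subrK.
- move=> vw; rewrite -[vw]hsubmxK; move: (lsubmx vw) (rsubmx vw) => v w.
  rewrite cE; split=> [vw0|[s]].
    have /b_ker[s sv] : comb b v = 0.
      rewrite -ghv; apply/fg_ex; exists (- comb a w).
      by apply/eqP; rewrite fN eq_sym -addr_eq0; apply/eqP.
    (* Subtracting the relation (s B', s C) from (v, w) leaves a relation among the generators of
       [L] alone. *)
    have /a_ker[t tw] : comb a (w - s *m C) = 0.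
      apply: f_inj; rewrite f0 -[RHS]vw0 -[w in RHS](subrK (s *m C)).
      by rewrite [_ - _ + _]addrC sv hfD hf add0r.
    exists (row_mx s t); rewrite mul_row_block mulmx0 addr0 -sv; congr row_mx.
    by rewrite -tw addrC subrK.
  rewrite -[s]hsubmxK; move: (lsubmx s) (rsubmx s) => s1 s2.
  rewrite mul_row_block mulmx0 addr0 => /eq_row_mx[-> ->].
  by rewrite hfD hf add0r (_ : comb a _ = 0) //; apply/a_ker; exists s2.
move=> v vB; apply/a_ker/f_inj.
by rewrite f0 -[RHS](hf v) vB comb0 add0r.
Qed.

End Combinations.

(** * Triangular modules and their direct summands *)

Section TriangularModules.
Variables (R : comNzRingType) (m : submodClosed R^o) (x y : R).
Hypothesis xy_min : part_of_minimal_generators m x y.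
Hypothesis xy0 : x * y = 0.

(** [U] is carried along because its rows are syzygies of the relations [T]; in an extension they
    constrain the block that glues two presentations. *)
Definition triangular_module (M : lmodType R) : Prop :=
  exists n (g : 'I_n -> M) (T U : 'M[R]_n),
    [/\ presented_by T g, upper_over m x T, upper_over m y U & U *m T = 0].

Lemma triangular_module_iso (M N : lmodType R) (f : M -> N) :
  linear f -> bijective f -> triangular_module M -> triangular_module N.
Proof.
move=> lf f_bij [n [g [T [U [Tg xT yU UT0]]]]]; exists n, (f \o g), T, U.
by split=> //; apply: presented_by_iso.
Qed.

Lemma triangular_module_extension (L M N : lmodType R) (f : L -> M) (g : M -> N) :
    linear f -> linear g -> injective f -> (forall v, exists u, g u = v) ->
    (forall u, g u = 0 <-> exists v, f v = u) ->
  triangular_module L -> triangular_module N -> triangular_module M.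
Proof.
move=> lf lg f_inj g_surj fg_ex [n [a [T [U [Ta xT yU UT0]]]]].
move=> [n' [b [T' [U' [Tb xT' yU' UT0']]]]].
have [C [c [Tc Csyz]]] :=
  presented_by_extension lf lg f_inj g_surj fg_ex Ta Tb.
(* The rows of [U'] are syzygies of [T'], so [C] sends them to relations of [L]. *)
have /choice[d dP] i : exists w, row i U' *m C = w *m T.
  by apply: Csyz; rewrite -row_mul UT0' row0.
pose D := \matrix_i d i.
have UCD : U' *m C = D *m T.
  by apply/row_matrixP => i; rewrite !row_mul rowK.
have CDm := upper_over_intertwine xy_min yU' xT UCD.
(* The block [- D] makes the off-diagonal block U' C - D T of the product vanish. *)
exists (n' + n)%N, c, (block_mx T' C 0 T), (block_mx U' (- D) 0 U); split=> //.
- by apply: upper_over_block => // i j; have [] := CDm i j.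
- apply: upper_over_block => // i j; have [_ Dm] := CDm i j.
  by rewrite mxE -mulN1r; apply: ideal_mull.
by rewrite mulmx_block UT0' UT0 UCD !mulmx0 !mul0mx mulNmx subrr !addr0 block_mx0.
Qed.

Lemma triangular_module_principal : triangular_module (quotmod (principal x)).
Proof.
pose S : submodClosed R^o := principal x; pose g (_ : 'I_1) := quotmod_pi S 1.
have gE v : comb g v = quotmod_pi S (v 0 0).
  by rewrite /comb big_ord1 /g -quotmod_piZ [_ *: _]mulr1.
exists 1%N, g, x%:M, y%:M; split; [split|..].
- move=> u; have [v <-] := quotmod_pi_surj u.
  by exists (v%:M); rewrite gE mxE.
- move=> v; rewrite gE quotmod_pi_eq0; split=> [/asboolP[b vb]|[w ->]].
    exists b%:M; rewrite -scalar_mxM -vb.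
    by apply/matrixP=> i j; rewrite !ord1 mxE.
  by apply/asboolP; exists (w 0 0); rewrite mul_mx_scalar mxE mulrC.
- exact: upper_over_scalar.
- exact: upper_over_scalar.
by rewrite -scalar_mxM mulrC xy0 raddf0.
Qed.

(* Writing u = sum_i v_i g_i, the relation y u = 0 is y v = c T for some row c. *)
Lemma triangular_module_annihilated (M : lmodType R) (u : M) :
    triangular_module M -> y *: u = 0 ->
  exists n (g : 'I_n -> M) (v : 'rV_n),
    (forall i, v 0 i \in m) /\ u = comb g v.
Proof.
move=> [n [g [T [_ [[g_surj g_ker] xT _ _]]]]] yu0.
have [v gv] := g_surj u; exists n, g, v; split=> // i.
have /g_ker[c vc] : comb g (y *: v) = 0 by rewrite combZ gv.
have yv : y%:M *m v = c *m T by rewrite mul_scalar_mx.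
by have [] := upper_over_intertwine xy_min (@upper_over_scalar _ m y) xT yv 0 i.
Qed.

(* The direct summands of triangular modules are
   stable under extensions because adding both complements to the middle term of
   an extension of summands gives an extension of triangular modules. *)
Definition triangular_summand (M : lmodType R) : Prop :=
  exists M' : lmodType R, triangular_module (M * M')%type.

Lemma triangular_summand_fin_gen M : triangular_summand M -> fin_gen M.
Proof.
move=> [M' [n [g [_ [_ [[g_surj _] _ _ _]]]]]]; exists n, (fst \o g) => u.
have [v gv] := g_surj (u, 0); exists (v 0).
by rewrite -[u]/((u, 0 : M').1) -gv (linear_comb _ _ (linearP fst)).
Qed.

Lemma triangular_module_summand M : triangular_module M -> triangular_summand M.
Proof.
exists 'rV[R]_0; apply: (triangular_module_iso (f := fun u => (u, 0))) H => //.
  by move=> a u v; congr (_, _); rewrite /= scaler0 addr0.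
by exists fst => // -[u v]; rewrite [v]thinmx0.
Qed.

Lemma triangular_summand_extension_closed : extension_closed triangular_summand.
Proof.
split; first split.
- exists (quotmod (principal x)).
  exact/triangular_module_summand/triangular_module_principal.
- exact: triangular_summand_fin_gen.
- move=> M N [f [f' fK f'K]] [M' tM]; exists M'.
  apply: (triangular_module_iso (f := fun u => (f u.1, u.2))) tM.
    by move=> a [u1 u2] [v1 v2]; rewrite /= linearP.
  by exists (fun u => (f' u.1, u.2)) => -[u v] /=; rewrite ?fK ?f'K.
- move=> M L N [f [f' fK f'K]] [M' tM]; exists (N * M')%type.
  apply: (triangular_module_iso (f := fun u => ((f u.1).1, ((f u.1).2, u.2)))) tM.
    by move=> a [u1 u2] [v1 v2]; rewrite /= linearP.
  exists (fun u => (f' (u.1, u.2.1), u.2.2)) => [[u v]|[u [v w]]] /=.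
    by rewrite -surjective_pairing fK.
  by rewrite f'K.
move=> L M N f g _ [f_inj g_surj fg_ex] [L' tL] [N' tN]; exists (L' * N')%type.
apply: (triangular_module_extension (f := fun u => (f u.1, (u.2, 0)))
  (g := fun u => (g u.1, u.2.2))) tL tN.
- move=> a [u1 u2] [v1 v2]; rewrite /= linearP; congr (_, (_, _)).
  by rewrite /= scaler0 addr0.
- by move=> a [u1 [u2 u3]] [v1 [v2 v3]]; rewrite /= linearP.
- by move=> [u1 u2] [v1 v2] [/f_inj -> ->].
- by move=> [v1 v2]; have [u <-] := g_surj v1; exists (u, (0, v2)).
move=> [u1 [u2 u3]] /=; split=> [[/fg_ex[v <-] ->]|[[v1 v2] [<- _ <-]]].
  by exists (v, u2).
by congr (_, _); apply/fg_ex; exists v1.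
Qed.

Lemma residue_field_not_triangular_summand :
  1 \notin m -> ~ triangular_summand (quotmod m).
Proof.
move=> m1 [M' tM]; have [_ ym _] := xy_min.
have scale_m (a : R) (u : quotmod m) : a \in m -> a *: u = 0.
  move=> am; have [b <-] := quotmod_pi_surj u; rewrite -quotmod_piZ.
  by apply/quotmod_pi_eq0; rewrite /GRing.scale /= mulrC; apply: ideal_mull.
(* As y lies in m, it kills [e], so [e] is a combination with coefficients in m. Its projection to
   R/m is then zero, although it is the class of 1. *)
pose e : (quotmod m * M')%type := (quotmod_pi m 1, 0).
have [|n [g [v [vm ev]]]] := triangular_module_annihilated (u := e) tM.
  by congr (_, _); rewrite /= ?scaler0 // scale_m.
suff /quotmod_pi_eq0 : quotmod_pi m (1 : R^o) = 0 by apply/negP.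
rewrite -[LHS]/(e.1) ev (linear_comb _ _ (linearP fst)).
by apply: big1 => i _; apply: scale_m.
Qed.

End TriangularModules.

(** * The extension closure and its nontriviality *)

Lemma ext_closure_extension_closed (R : comNzRingType) (X : lmodType R) :
  (exists2 C, extension_closed C & C X) -> extension_closed (ext_closure X).
Proof.
move=> [C0 C0ext C0X]; split; first split.
- by exists X.
(* Finite generation is inherited from [C0], one of the classes being intersected. *)
- by move=> M /(_ _ C0ext C0X); case: C0ext => -[_ + _ _ _]; apply.
- by move=> M N isoMN XM C Cext CX; case: (Cext) => -[_ _ /(_ _ _ isoMN)] + _ _;
    apply; apply: XM.
- by move=> M L N isoM XM C Cext CX; case: (Cext) => _ /(_ _ _ _ isoM) + _;
    apply; apply: XM.
move=> L M N f g fgM fg_ex XL XN C Cext CX.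
by case: (Cext) => _ _ /(_ _ _ _ _ _ fgM fg_ex); apply; [apply: XL|apply: XN].
Qed.

Theorem mainTheorem1 (R : comNzRingType) (m : submodClosed R^o)
    (R_noeth : noetherian_ring R) (R_local : local_ring m) (x y : R)
    (xy_min : part_of_minimal_generators m x y) (xy0 : x * y = 0) :
  ~ ext_closure (quotmod (principal x)) (quotmod m) /\
  nontrivial_extension_closed (ext_closure (quotmod (principal x))).
Proof.
have [[m1 _] _] := R_local; have [xm ym indep] := xy_min.
have Cext := triangular_summand_extension_closed xy_min xy0.
have CX : triangular_summand m x y (quotmod (principal x)).
  exact/triangular_module_summand/triangular_module_principal.
have kN : ~ ext_closure (quotmod (principal x)) (quotmod m).
  by move/(_ _ Cext CX); apply: residue_field_not_triangular_summand.
have XX : ext_closure (quotmod (principal x)) (quotmod (principal x)) by [].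
have X_neq0 : quotmod_pi (principal x) (1 : R^o) <> 0.
  move/quotmod_pi_eq0/asboolP => [b b1]; case/negP: m1.
  by rewrite b1; apply: ideal_mull.
(* If x = 0, then 1 x + 0 y lies in m^2, and independence puts 1 in m. *)
have x_neq0 : x <> 0.
  move=> x0; have := indep 1 0; rewrite x0 mulr0 mul0r addr0.
  by case=> [|/(negP m1)] //; apply: in_square0.
split=> //; split.
- by apply: ext_closure_extension_closed; exists (triangular_summand m x y).
- by move=> /(_ (quotmod (principal x)))[/(_ XX) zX _]; apply: X_neq0; apply: zX.
(* If R/(x) were free of rank n, x would kill R^n: n = 0 contradicts R/(x) being nonzero, and n > 0
   gives x = 0. *)
- move=> /(_ (quotmod (principal x)))[/(_ XX)[n [f [f' fK f'K]]] _].
  have x_ann (u : quotmod (principal x)) : x *: u = 0.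
    have [b <-] := quotmod_pi_surj u; rewrite -quotmod_piZ; apply/quotmod_pi_eq0.
    by apply/asboolP; exists b; rewrite /GRing.scale /= mulrC.
  have xrow (v : 'rV[R]_n) : x *: v = 0.
    by apply: (can_inj fK); rewrite linearZ /= x_ann linear0.
  case: n f f' fK f'K xrow => [|n] f f' fK f'K xrow.
    by apply: X_neq0; rewrite -[LHS]f'K [f' _]thinmx0 linear0.
  apply: x_neq0; have /matrixP/(_ 0 0) := xrow (const_mx 1).
  by rewrite !mxE mulr1.
(* R/m is generated by the class of 1, so it separates the closure from mod R. *)
move=> /(_ (quotmod m))[_ mX]; refine (kN (mX _)).
exists 1%N, (fun _ => quotmod_pi m 1) => u; have [b <-] := quotmod_pi_surj u.
by exists (fun _ => b); rewrite big_ord1 -quotmod_piZ [_ *: _]mulr1.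
Qed.
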